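(* The triple $(\mathcal{H}_{\ge1,+},\ \sqcup,\ I)$ is the free commutative nonunitary Rota–Baxter $\mathbb{Q}$-algebra of weight $0$ generated by $[1]$: $I$ is a Rota–Baxter operator of weight $0$ for $\sqcup$, and for every commutative nonunitary Rota–Baxter $\mathbb{Q}$-algebra $(R,P)$ of weight $0$ and every $r\in R$ there is a unique homomorphism of nonunitary Rota–Baxter algebras $f:\mathcal{H}_{\ge1,+}\to R$ with $f([1])=r$.
   Context: A nonunitary Rota–Baxter $\mathbb{Q}$-algebra of weight $0$ is a (not necessarily unital) $\mathbb{Q}$-algebra $R$ with a linear $P:R\to R$ such that $P(x)P(y)=P(xP(y))+P(P(x)y)$; homomorphisms are algebra maps commuting with the operators. On words in letters $x_0,x_1$ the shuffle product $\sqcup\!\sqcup$ is defined by $1\sqcup\!\sqcup w=w\sqcup\!\sqcup 1=w$ and $(au)\sqcup\!\sqcup(bv)=a(u\sqcup\!\sqcup bv)+b(au\sqcup\!\sqcup v)$ for letters $a,b$, extended bilinearly. Let $\mathcal{H}^{\sqcup\!\sqcup}_{1,+}$ be the $\mathbb{Q}$-span of words $x_0^{s_1-1}x_1\cdots x_0^{s_k-1}x_1$ ($k\ge1$, $s_i\ge1$); it is closed under $\sqcup\!\sqcup$. Let $\mathcal{H}_{\ge1,+}$ be the $\mathbb{Q}$-vector space with basis the symbols $[s_1,\dots,s_k]$, $k\ge1$, $s_i\in\mathbb{Z}_{\ge1}$, and let $\eta:\mathcal{H}^{\sqcup\!\sqcup}_{1,+}\to\mathcal{H}_{\ge1,+}$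 be the linear bijection $x_0^{s_1-1}x_1\cdots x_0^{s_k-1}x_1\mapsto[s_1,\dots,s_k]$. Define the product $[\vec s]\sqcup[\vec t]=\eta(\eta^{-1}([\vec s])\sqcup\!\sqcup\eta^{-1}([\vec t]))$ and the linear operator $I([s_1,s_2,\dots,s_k])=[s_1+1,s_2,\dots,s_k]$ on $\mathcal{H}_{\ge1,+}$. *)

(* Defs.v *)
(* A vector space with basis K is rendered as {malg rat[K]}, the finitely
   supported functions K -> rat, with basis vectors << k >>. *)
From HB Require Import structures.
From mathcomp Require Import all_boot all_order all_algebra.
From mathcomp Require Import finmap.
From mathcomp Require Import monalg.

Set Implicit Arguments.
Unset Strict Implicit.
Unset Printing Implicit Defensive.

Import GRing.Theory.
Local Open Scope ring_scope.

Section LinearExtension.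
Variables (K : choiceType) (V : lmodType rat).

Definition lext (f : K -> V) (u : {malg rat[K]}) : V :=
  \sum_(k <- msupp u) u@_k *: f k.

Lemma lextE (f : K -> V) (u : {malg rat[K]}) (d : {fset K}) :
  (msupp u `<=` d)%fset -> lext f u = \sum_(k <- d) u@_k *: f k.
Proof.
move=> sud; rewrite /lext; apply/big_fset_incl => // k _ /mcoeff_outdom ->.
by rewrite scale0r.
Qed.

Lemma lext_is_linear (f : K -> V) : linear (lext f).
Proof.
move=> a u v; set d := (msupp u `|` msupp v)%fset.
rewrite (@lextE f u d) ?fsubsetUl // (@lextE f v d) ?fsubsetUr //.
rewrite (@lextE f _ d); last first.
  apply: fsubset_trans (msuppD_le _ _) _; apply: fsetSU.
  exact: msuppZ_le.
rewrite scaler_sumr -big_split /=; apply: eq_bigr => k _.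
by rewrite mcoeffD mcoeffZ scalerDl scalerA.
Qed.

HB.instance Definition _ (f : K -> V) :=
  GRing.isLinear.Build rat {malg rat[K]} V _ (lext f) (lext_is_linear f).

Lemma lextU (f : K -> V) k : lext f << k >> = f k.
Proof.
by rewrite /lext msuppU oner_eq0 big_seq_fset1 mcoeffUU scale1r.
Qed.

Lemma malg_sumZ (u : {malg rat[K]}) : u = \sum_(k <- msupp u) u@_k *: << k >>.
Proof.
rewrite {1}[u]monalgE; apply: eq_bigr => k _.
by apply/malgP => k'; rewrite mcoeffZ !mcoeffU mulrnAr mulr1.
Qed.

End LinearExtension.

(* Associativity, commutativity, bilinearity; no unit is required. *)
Record com_nonunitary_RBalgebra (R : lmodType rat)
    (mul : R -> R -> R) (P : R -> R) : Prop := ComNonunitaryRBalgebra {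
  rb_mulA : associative mul;
  rb_mulC : commutative mul;
  rb_mul_linearl : forall y, linear (mul ^~ y);
  rb_mul_linearr : forall x, linear (mul x);
  rb_op_linear : linear P;
  rb_op_weight0 : forall x y, mul (P x) (P y) = P (mul x (P y)) + P (mul (P x) y)
}.

Record nonunitary_RBhom (R S : lmodType rat)
    (mulR : R -> R -> R) (PR : R -> R) (mulS : S -> S -> S) (PS : S -> S)
    (f : R -> S) : Prop := NonunitaryRBhom {
  rbhom_linear : linear f;
  rbhom_mul : {morph f : x y / mulR x y >-> mulS x y};
  rbhom_op : {morph f : x / PR x >-> PS x}
}.

Definition letter := bool.
Definition x0 : letter := false.
Definition x1 : letter := true.
Notation word := (seq letter).
Notation Qword := {malg rat[word]}.

Definition prepend (a : letter) : Qword -> Qword :=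
  lext (fun w : word => << a :: w >>).

Fixpoint shuffle_word (u : word) : word -> Qword :=
  match u with
  | [::] => fun v => << v >>
  | a :: u' =>
      fix shuffle_u (v : word) : Qword :=
        match v with
        | [::] => << u >>
        | b :: v' => prepend a (shuffle_word u' v) + prepend b (shuffle_u v')
        end
  end.

Definition shuffle (x y : Qword) : Qword :=
  lext (fun u => lext (shuffle_word u) y) x.

(* The symbols [s_1, ..., s_k] with k >= 1 and all s_i >= 1. *)
Record composition := Composition {
  parts :> seq nat;
  _ : (parts != [::]) && all (fun s => 0 < s)%N parts
}.
HB.instance Definition _ := [isSub for parts].
HB.instance Definition _ := [Choice of composition by <:].

Notation H_ge1 := {malg rat[composition]}.

Definition word_of (s : composition) : word :=
  flatten [seq rcons (nseq si.-1 x0) x1 | si <- s].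

(* The Q-span of the words x0^(s_1 - 1) x1 ... x0^(s_k - 1) x1. *)
Definition H1_shuffle (x : Qword) : Prop :=
  exists c : seq (rat * composition), x = \sum_(p <- c) p.1 *: << word_of p.2 >>.

(* Lengths, plus one, of the blocks of x0's preceding each x1; n counts the
   x0's already read in the current block. *)
Fixpoint blocks (n : nat) (w : word) : seq nat :=
  match w with
  | [::] => [::]
  | a :: w' => if a == x1 then n.+1 :: blocks 0 w' else blocks n.+1 w'
  end.

(* eta is only meaningful on H1_shuffle; words not in the image of word_of get
   a junk value. Lemmas eta_invK, eta_inv_H1 and etaK below show that eta is a
   bijection from H1_shuffle onto H_ge1 with inverse eta_inv, and H1_shuffle_closed
   that mul_H only applies eta to elements of H1_shuffle. *)
Definition eta : Qword -> H_ge1 :=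
  lext (fun w => oapp (fun s : composition => << s >>) 0 (insub (blocks 0 w))).

Definition eta_inv : H_ge1 -> Qword :=
  lext (fun s => << word_of s >>).

Definition mul_H (u v : H_ge1) : H_ge1 := eta (shuffle (eta_inv u) (eta_inv v)).

Lemma incr_head_subproof (s : composition) :
  let t := (head 0 s).+1 :: behead s in
  ((t != [::]) && all (fun s => 0 < s) t)%N.
Proof. by case: s => -[|n s] //= /andP[]. Qed.

Definition incr_head (s : composition) : composition := Composition (incr_head_subproof s).

Definition I_H : H_ge1 -> H_ge1 := lext (fun s => << incr_head s >>).

Definition comp1 : composition := @Composition [:: 1%N] isT.

HB.instance Definition _ a := GRing.isLinear.Build rat _ _ _ (prepend a)
  (lext_is_linear _).
HB.instance Definition _ := GRing.isLinear.Build rat _ _ _ eta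
  (lext_is_linear _).
HB.instance Definition _ := GRing.isLinear.Build rat _ _ _ eta_inv
  (lext_is_linear _).
HB.instance Definition _ := GRing.isLinear.Build rat _ _ _ I_H
  (lext_is_linear _).

Lemma blocks_nseq n m w :
  blocks n (rcons (nseq m x0) x1 ++ w) = (n + m).+1 :: blocks 0 w.
Proof. by elim: m n => [|m IH] n /=; rewrite ?addn0 // IH addSnnS. Qed.

Lemma word_ofK (s : composition) : blocks 0 (word_of s) = s.
Proof.
rewrite /word_of; case: s => s /= /andP[_]; elim: s => //= n s IH /andP[n0 /IH {}IH].
by rewrite blocks_nseq IH add0n prednK.
Qed.

Lemma eta_word (s : composition) : eta << word_of s >> = << s >>.
Proof.
by rewrite /eta lextU word_ofK valK.
Qed.

Lemma eta_inv_U (s : composition) : eta_inv << s >> = << word_of s >>.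
Proof. exact: lextU. Qed.

Lemma eta_invK : cancel eta_inv eta.
Proof.
move=> u; rewrite (malg_sumZ u); move: (enum_fset _) => r.
rewrite [eta_inv _]linear_sum linear_sum; apply: eq_bigr => s _; by rewrite !linearZ /= eta_inv_U eta_word.
Qed.

Lemma eta_inv_H1 (u : H_ge1) : H1_shuffle (eta_inv u).
Proof.
by exists [seq (u@_s, s) | s <- enum_fset (msupp u)]; rewrite big_map.
Qed.

Lemma etaK (x : Qword) : H1_shuffle x -> eta_inv (eta x) = x.
Proof.
case=> c ->; rewrite [eta _]linear_sum linear_sum; apply: eq_bigr => p _.
by rewrite !linearZ /= eta_word eta_inv_U.
Qed.

Lemma H1_shuffle0 : H1_shuffle 0.
Proof. by exists [::]; rewrite big_nil. Qed.

Lemma H1_shuffleD x y : H1_shuffle x -> H1_shuffle y -> H1_shuffle (x + y).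
Proof. by case=> c -> [d ->]; exists (c ++ d); rewrite big_cat. Qed.

Lemma H1_shuffleZ a x : H1_shuffle x -> H1_shuffle (a *: x).
Proof.
case=> c ->; exists [seq (a * p.1, p.2) | p <- c].
by rewrite big_map scaler_sumr; apply: eq_bigr => p _; rewrite scalerA.
Qed.

Lemma H1_shuffle_sum T (r : seq T) (F : T -> Qword) :
  (forall i, H1_shuffle (F i)) -> H1_shuffle (\sum_(i <- r) F i).
Proof. by move=> HF; apply: big_ind => // [|x y]; [exact: H1_shuffle0|exact: H1_shuffleD]. Qed.

Lemma blocksK n w : last (n == 0)%N w ->
  flatten [seq rcons (nseq si.-1 x0) x1 | si <- blocks n w] = nseq n x0 ++ w.
Proof.
elim: w n => [|[] w IH] n /=; first by case: n.
  by move=> /(IH 0%N) ->; rewrite cat_rcons.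
by move=> /(IH n.+1) ->; rewrite -[x0 :: w]cat1s catA -(nseqD n 1) addn1.
Qed.

Lemma blocks_gt0 n w : all (fun s => 0 < s)%N (blocks n w).
Proof. by elim: w n => [|[] w IH] n /=. Qed.

Lemma H1_shuffleU w : last x0 w -> H1_shuffle << w >>.
Proof.
case: w => // a w lw.
have p : (blocks 0 (a :: w) != [::]) && all (fun s => 0 < s)%N (blocks 0 (a :: w)).
  rewrite blocks_gt0 andbT; apply/eqP => b0.
  by have := @blocksK 0 (a :: w) lw; rewrite b0.
exists [:: (1, Composition p)]; rewrite big_seq1 scale1r /word_of /=.
by rewrite (@blocksK 0 (a :: w)).
Qed.

Lemma word_of_last s : last x0 (word_of s).
Proof.
rewrite /word_of; case: s => s /= /andP[].
case: s => // n s _ _ /=; rewrite last_cat last_rcons.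
by elim: s => //= m s; rewrite last_cat last_rcons.
Qed.

Lemma H1_shuffle_prepend a x : H1_shuffle x -> H1_shuffle (prepend a x).
Proof.
case=> c ->; rewrite linear_sum; apply: H1_shuffle_sum => p.
rewrite linearZ /=; apply: H1_shuffleZ; rewrite /prepend lextU; apply: H1_shuffleU.
by have := word_of_last p.2; case: (word_of p.2).
Qed.

Lemma H1_shuffle_word u v : last x1 u -> last x1 v -> u ++ v != [::] ->
  H1_shuffle (shuffle_word u v).
Proof.
elim: u v => [|a u IHu]; first by case=> //= b v _ lv _; exact: H1_shuffleU.
elim=> [|b v IHv] lu lv _; first exact: H1_shuffleU.
apply: H1_shuffleD; apply: H1_shuffle_prepend.
  by apply: IHu => //; [case: {+}u lu | case: {+}u].
by apply: IHv => //; case: {+}v lv.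
Qed.

Lemma H1_shuffle_closed x y :
  H1_shuffle x -> H1_shuffle y -> H1_shuffle (shuffle x y).
Proof.
move=> [c ->] [d ->]; rewrite /shuffle linear_sum.
apply: H1_shuffle_sum => p; rewrite linearZ /=; apply: H1_shuffleZ.
rewrite lextU linear_sum.
apply: H1_shuffle_sum => q; rewrite linearZ /=; apply: H1_shuffleZ.
rewrite lextU.
have := word_of_last p.2; have := word_of_last q.2.
by case: (word_of p.2) (word_of q.2) => [|? ?] [|? ?] // ? ?; apply: H1_shuffle_word.
Qed.

(* Main.v *)
(* Write sh for the shuffle product and identify [s_1, ..., s_k] with its word.
   H is generated from x1 by prepending x0 and shuffling with x1, because
     x1 sh x1^n x0 w = (n+1) x1^(n+1) x0 w + x1^n x0 (x1 sh w).
   The same identity dictates the homomorphism: with m the multiplication by r,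
     f (x1^n x0 w) = (ad m)^n (P) / n! (f w)   and   f (x1^n) = r^n / n!.
   Then f (x1 sh v) = r f (v) by induction on v, and multiplicativity of f
   follows by induction along the generation of H. *)
Require Import Defs.
From HB Require Import structures.
From mathcomp Require Import all_boot all_order all_algebra.
From mathcomp Require Import finmap.
From mathcomp Require Import monalg.

Set Implicit Arguments.
Unset Strict Implicit.
Unset Printing Implicit Defensive.

Import GRing.Theory.
Local Open Scope ring_scope.

(** * Linear maps and transfer of Rota-Baxter structure *)

Section LinearMaps.
Variables (U V : lmodType rat) (f : U -> V).
Hypothesis lin_f : linear f.

Lemma linear_addE : {morph f : x y / x + y}.
Proof. by move=> x y; rewrite -[x]scale1r lin_f !scale1r. Qed.

Lemma linear_0E : f 0 = 0.
Proof. by apply: (addrI (f 0)); rewrite -linear_addE !addr0. Qed.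

End LinearMaps.

(** All axioms are equations, so they pull back along an injective morphism. With [i := eta_inv]
    this reduces the axioms for [mul_H] and [I_H] to those of the shuffle algebra on all words. *)
Lemma RBalgebra_sub (A B : lmodType rat) (mA : A -> A -> A) (PA : A -> A)
    (mB : B -> B -> B) (PB : B -> B) (i : A -> B) :
  injective i -> linear i -> {morph i : x y / mA x y >-> mB x y} ->
  {morph i : x / PA x >-> PB x} ->
  com_nonunitary_RBalgebra mB PB -> com_nonunitary_RBalgebra mA PA.
Proof.
move=> inj_i lin_i iM iP [BA BC Bl Br BP Bw]; split.
- by move=> x y z; apply: inj_i; rewrite !iM BA.
- by move=> x y; apply: inj_i; rewrite !iM BC.
- by move=> z a x y; apply: inj_i; rewrite lin_i !iM lin_i Bl.
- by move=> z a x y; apply: inj_i; rewrite lin_i !iM lin_i Br.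
- by move=> a x y; apply: inj_i; rewrite lin_i !iP lin_i BP.
- move=> x y; apply: inj_i.
  by rewrite (linear_addE lin_i) !(iM, iP) Bw.
Qed.

(** Double induction along the generation of [A]: first on the left factor for all right factors,
    then on the right factor when the left one is [PA x]. *)
Lemma RBalgebra_morph_gen (A B : lmodType rat) (mA : A -> A -> A)
    (PA : A -> A) (mB : B -> B -> B) (PB : B -> B) (e : A) (f : A -> B) :
  com_nonunitary_RBalgebra mA PA -> com_nonunitary_RBalgebra mB PB ->
  (forall Q : A -> Prop,
     (forall a x y, Q x -> Q y -> Q (a *: x + y)) -> Q e ->
     (forall x, Q x -> Q (PA x)) -> (forall x, Q x -> Q (mA e x)) ->
     forall x, Q x) ->
  linear f -> {morph f : x / PA x >-> PB x} ->
  (forall x, f (mA e x) = mB (f e) (f x)) ->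
  {morph f : x y / mA x y >-> mB x y}.
Proof.
move=> [AA AC Al Ar _ Aw] [BA BC Bl Br _ Bw] ind lf fP fe.
apply: (ind) => [a x x' ex ex'||x IHx|x IHx].
- by move=> y; rewrite Al !lf Bl ex ex'.
- exact: fe.
- apply: (ind) => [a y y' ey ey'||y IHy|y IHy].
  + by rewrite Ar !lf Br ey ey'.
  + by rewrite AC fe BC.
  (* The weight 0 identity leaves the products of [x] with [PA y], settled by the outer hypothesis,
     and of [PA x] with [y], settled by the inner one. *)
  + by rewrite Aw (linear_addE lf) !fP IHx IHy !fP -Bw.
  + by rewrite AA (AC _ e) -AA !fe IHy !BA (BC (f e)).
- by move=> y; rewrite -AA !fe IHx BA.
Qed.

Lemma malg_ind (K : choiceType) (Q : {malg rat[K]} -> Prop) :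
  Q 0 -> (forall a x y, Q x -> Q y -> Q (a *: x + y)) ->
  (forall k, Q << k >>) -> forall x, Q x.
Proof.
move=> Q0 Qlin QU x; rewrite (malg_sumZ x).
by elim: (enum_fset _) => [|k r IH]; rewrite ?big_nil // big_cons; apply: Qlin.
Qed.

Lemma malg_linear_ext (K : choiceType) (V : lmodType rat)
    (f g : {malg rat[K]} -> V) :
  linear f -> linear g -> (forall k, f << k >> = g << k >>) -> f =1 g.
Proof.
move=> lf lg fg; apply: malg_ind => // [|a x y ex ey].
  by rewrite !linear_0E.
by rewrite lf lg ex ey.
Qed.

(** * The shuffle algebra on all words *)

Lemma prependU a w : prepend a << w >> = << a :: w >>.
Proof. exact: lextU. Qed.

Lemma shuffleU u v : shuffle << u >> << v >> = shuffle_word u v.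
Proof. by rewrite /shuffle !lextU. Qed.

Lemma shuffle_linearl y : linear (shuffle ^~ y).
Proof. by move=> a u v; rewrite /shuffle linearP. Qed.

Lemma shuffle_linearr x : linear (shuffle x).
Proof.
move=> a u v; elim/malg_ind: x => [|b x y ex ey|w].
- by rewrite !(linear_0E (shuffle_linearl _)) scaler0 addr0.
- rewrite !shuffle_linearl ex ey !(scalerDr b) (scalerA b a) (mulrC b).
  by rewrite addrACA -(scalerA a b) -(scalerDr a).
- by rewrite /shuffle !lextU linearP.
Qed.

Lemma shuffle1l x : shuffle << [::] >> x = x.
Proof.
by elim/malg_ind: x => [|a x y ex ey|w];
  rewrite ?(linear_0E (shuffle_linearr _)) ?shuffle_linearr ?ex ?ey ?shuffleU.
Qed.

(** Bilinear form of the recursion on words; for [a = b = x0] it is the Rota-Baxter identity of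
    [prepend x0]. *)
Lemma shuffle_prepend a b x y :
  shuffle (prepend a x) (prepend b y) =
  prepend a (shuffle x (prepend b y)) + prepend b (shuffle (prepend a x) y).
Proof.
elim/malg_ind: x => [|c x x' ex ex'|u].
- by rewrite !linear0 !(linear_0E (shuffle_linearl _)) !linear0 addr0.
- rewrite linearP !shuffle_linearl ex ex' !linearP /= scalerDr.
  by rewrite addrACA.
elim/malg_ind: y => [|c y y' ey ey'|v].
- by rewrite !linear0 !(linear_0E (shuffle_linearr _)) !linear0 addr0.
- rewrite linearP !shuffle_linearr ey ey' !linearP /= scalerDr.
  by rewrite addrACA.
by rewrite !prependU !shuffleU.
Qed.

Lemma shuffle_word_cons a b u v :
  shuffle_word (a :: u) (b :: v) =
  prepend a (shuffle_word u (b :: v)) + prepend b (shuffle_word (a :: u) v).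
Proof. by []. Qed.

Lemma shuffle_wordC u v : shuffle_word u v = shuffle_word v u.
Proof.
elim: u v => [|a u IHu]; first by case.
elim=> [//|b v IHv].
by rewrite !shuffle_word_cons IHu IHv addrC.
Qed.

Lemma shuffleC : commutative shuffle.
Proof.
move=> x y; move: x; apply: malg_linear_ext.
- exact: shuffle_linearl.
- exact: shuffle_linearr.
move=> u; move: y; apply: malg_linear_ext.
- exact: shuffle_linearr.
- exact: shuffle_linearl.
by move=> v; rewrite !shuffleU shuffle_wordC.
Qed.

Lemma shuffle1r x : shuffle x << [::] >> = x.
Proof. by rewrite shuffleC shuffle1l. Qed.

(** Both bracketings split into three terms according to the first letter of the result, and the
    three hypotheses match them term by term. *)
Lemma assoc_step (V : zmodType) (m : V -> V -> V) (p : letter -> V -> V) :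
  (forall a, {morph p a : x y / x + y}) ->
  commutative m -> right_distributive m +%R ->
  (forall a b x y, m (p a x) (p b y) = p a (m x (p b y)) + p b (m (p a x) y)) ->
  forall a b c x y z,
    m x (m (p b y) (p c z)) = m (m x (p b y)) (p c z) ->
    m (p a x) (m y (p c z)) = m (m (p a x) y) (p c z) ->
    m (p a x) (m (p b y) z) = m (m (p a x) (p b y)) z ->
    m (p a x) (m (p b y) (p c z)) = m (m (p a x) (p b y)) (p c z).
Proof.
move=> pD mC mDr mp a b c x y z ex ey ez.
have mp3 a' b' c' x' y' z' : m (p a' x') (m (p b' y') (p c' z')) =
    p a' (m x' (m (p b' y') (p c' z'))) +
    (p b' (m (p a' x') (m y' (p c' z'))) +
     p c' (m (p a' x') (m (p b' y') z'))).
  by rewrite {1 2}mp !mDr (mp a' b') (mp a' c') addrACA pD.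
(* Commutativity turns the other bracketing into one that [mp3] expands too, with [c] as the first
   of the three letters. *)
rewrite mp3 ex ey ez [RHS]mC mp3 [RHS]addrC addrA.
by rewrite (mC z) !(mC (p c z)).
Qed.

Lemma shuffle_wordA u v w :
  shuffle << u >> (shuffle << v >> << w >>) =
  shuffle (shuffle << u >> << v >>) << w >>.
Proof.
elim: u v w => [|a u IHu] v w; first by rewrite !shuffle1l.
elim: v w => [|b v IHv] w; first by rewrite shuffle1l shuffle1r.
elim: w => [|c w IHw]; first by rewrite !shuffle1r.
have := IHu (b :: v) (c :: w); have := IHv (c :: w); move: IHw.
rewrite -!prependU => ew ev eu.
apply: (assoc_step _ shuffleC _ shuffle_prepend) eu ev ew => [d x y|x y z].
  exact: linearD.
exact: (linear_addE (shuffle_linearr x)).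
Qed.

Lemma shuffleA : associative shuffle.
Proof.
move=> x y z; elim/malg_ind: x => [|a x x' ex ex'|u].
- by rewrite !(linear_0E (shuffle_linearl _)).
- by rewrite !shuffle_linearl ex ex'.
elim/malg_ind: y => [|a y y' ey ey'|v].
- by rewrite (linear_0E (shuffle_linearl _)) (linear_0E (shuffle_linearr _))
    (linear_0E (shuffle_linearl _)).
- by rewrite shuffle_linearl !shuffle_linearr shuffle_linearl ey ey'.
elim/malg_ind: z => [|a z z' ez ez'|w].
- by rewrite !(linear_0E (shuffle_linearr _)).
- by rewrite !shuffle_linearr ez ez'.
exact: shuffle_wordA.
Qed.

(** * Generation of the words ending in x1 *)

Lemma shuffle_x1_prepend a x :
  shuffle << [:: x1] >> (prepend a x) =
  prepend x1 (prepend a x) + prepend a (shuffle << [:: x1] >> x).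
Proof. by rewrite -prependU shuffle_prepend shuffle1l. Qed.

(** The inserted [x1] lands before one of the [n] leading letters, each time with the same result,
    or after all of them. *)
Lemma shuffle_x1_iter n y :
  shuffle << [:: x1] >> (iter n (prepend x1) y) =
  n%:R *: iter n.+1 (prepend x1) y +
    iter n (prepend x1) (shuffle << [:: x1] >> y).
Proof.
elim: n => [|n IH]; first by rewrite scale0r add0r.
rewrite iterS shuffle_x1_prepend IH linearP /= addrA; congr (_ + _).
by rewrite -[n.+1]add1n natrD scalerDl scale1r.
Qed.

Section Generation.
Variable Q : Qword -> Prop.
Hypothesis Q_linear : forall a x y, Q x -> Q y -> Q (a *: x + y).
Hypothesis Q_x1 : Q << [:: x1] >>.
Hypothesis Q_prepend_x0 : forall x, Q x -> Q (prepend x0 x).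
Hypothesis Q_shuffle_x1 : forall x, Q x -> Q (shuffle << [:: x1] >> x).

Let Q0 : Q 0.
Proof. by rewrite -(addNr (<< [:: x1] >> : Qword)) -scaleN1r; apply: Q_linear. Qed.

Let QZ a x : Q x -> Q (a *: x).
Proof. by move=> Qx; rewrite -[a *: x]addr0; apply: Q_linear. Qed.

(** Here division by positive integers enters: the generation argument only produces multiples of
    the wanted words. *)
Let QZI n x : Q (n.+1%:R *: x) -> Q x.
Proof.
move=> /(QZ n.+1%:R^-1); rewrite scalerA mulVf ?scale1r //.
by rewrite Num.Theory.pnatr_eq0.
Qed.

Let Q_iter_x0 n x : Q x -> Q (iter n (prepend x1) (prepend x0 x)).
Proof.
elim: n x => [|n IH] x Qx /=; first exact: Q_prepend_x0.
apply: (QZI (n := n)); set y := iter n _ _.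
have -> : n.+1%:R *: prepend x1 y = (-1) *: iter n (prepend x1)
    (prepend x0 (shuffle << [:: x1] >> x)) + shuffle << [:: x1] >> y.
  rewrite shuffle_x1_iter shuffle_x1_prepend.
  have -> z z' : iter n (prepend x1) (z + z') =
      iter n (prepend x1) z + iter n (prepend x1) z'.
    by elim: n {IH y} => //= n ->; rewrite linearD.
  rewrite -iterSr scaleN1r addrC addrA addrK.
  by rewrite -[in LHS]addn1 natrD scalerDl scale1r.
(* The induction hypothesis is needed at [x1] shuffled with [x] as well as at [x], hence the
   induction for all [x]. *)
by apply: Q_linear; [apply/IH/Q_shuffle_x1 | apply/Q_shuffle_x1/IH].
Qed.

Let Q_iter_nil n : Q (iter n.+1 (prepend x1) << [::] >>).
Proof.
elim: n => [|n IH]; first by rewrite /= prependU.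
(* Shuffling [x1] with [x1^(n+1)] gives [n+2] copies of [x1^(n+2)]. *)
apply: (QZI (n := n.+1)).
have := Q_shuffle_x1 IH; rewrite shuffle_x1_iter shuffle1r -prependU -iterSr.
by rewrite -{2}[iter _ _ _]scale1r -scalerDl -(natrD _ n.+1 1) addn1.
Qed.

(** The counter [n] holds the [x1] letters already read. The default [0 < n] of [last] makes the
    condition say that the whole word [x1^n w] ends in [x1], also for empty [w]. *)
Let Q_iter_word n w : last (0 < n)%N w -> Q (iter n (prepend x1) << w >>).
Proof.
elim: w n => [|[] w IH] n /=; first by case: n.
  by move=> /(IH n.+1); rewrite iterSr prependU.
by move=> /(IH 0%N) Qw; rewrite -prependU; apply: Q_iter_x0.
Qed.

Lemma last_x1_ind w : last x0 w -> Q << w >>.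
Proof. exact: (@Q_iter_word 0). Qed.

End Generation.

(** * Transport from words to compositions *)

Lemma eta_inv_comp1 : eta_inv << comp1 >> = << [:: x1] >> :> Qword.
Proof. by rewrite eta_inv_U. Qed.

Lemma word_of_incr_head s : word_of (incr_head s) = x0 :: word_of s.
Proof. by case: s => -[|[|n] s]. Qed.

Lemma eta_inv_I u : eta_inv (I_H u) = prepend x0 (eta_inv u).
Proof.
elim/malg_ind: u => [|a u v eu ev|s]; first by rewrite !linear0.
  by rewrite !linearP /= eu ev.
by rewrite /I_H lextU !eta_inv_U prependU word_of_incr_head.
Qed.

Lemma eta_inv_mul u v : eta_inv (mul_H u v) = shuffle (eta_inv u) (eta_inv v).
Proof. by rewrite etaK //; apply: H1_shuffle_closed; apply: eta_inv_H1. Qed.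

Lemma eta_inv_inj : injective eta_inv.
Proof. exact: can_inj eta_invK. Qed.

Lemma shuffle_RB : com_nonunitary_RBalgebra shuffle (prepend x0).
Proof.
split; [exact: shuffleA | exact: shuffleC | exact: shuffle_linearl
  | exact: shuffle_linearr | exact: linearP | exact: shuffle_prepend].
Qed.

Lemma mul_H_RB : com_nonunitary_RBalgebra mul_H I_H.
Proof.
apply: (RBalgebra_sub eta_inv_inj) shuffle_RB.
- exact: linearP.
- exact: eta_inv_mul.
- exact: eta_inv_I.
Qed.

Lemma H_ge1_ind (Q : H_ge1 -> Prop) :
  (forall a u v, Q u -> Q v -> Q (a *: u + v)) -> Q << comp1 >> ->
  (forall u, Q u -> Q (I_H u)) -> (forall u, Q u -> Q (mul_H << comp1 >> u)) ->
  forall u, Q u.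
Proof.
move=> Qlin Q1 QI Qmul; apply: malg_ind => // [|s].
  by rewrite -(addNr (<< comp1 >> : H_ge1)) -scaleN1r; apply: Qlin.
(* The predicate is pushed forward along [eta_inv], whose injectivity brings the conclusion back. *)
have /(_ (fun x => exists2 u, eta_inv u = x & Q u)) ind := last_x1_ind.
have [||||u eu] := ind _ _ _ _ (word_of s) (word_of_last s).
- by move=> a _ _ [u <- Qu] [v <- Qv]; exists (a *: u + v); rewrite ?linearP; auto.
- by exists << comp1 >>; rewrite ?eta_inv_comp1.
- by move=> _ [u <- Qu]; exists (I_H u); rewrite ?eta_inv_I; auto.
- move=> _ [u <- Qu]; exists (mul_H << comp1 >> u); last exact: Qmul.
  by rewrite eta_inv_mul eta_inv_comp1.
by rewrite -eta_inv_U in eu; rewrite (eta_inv_inj eu).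
Qed.

(** * Construction of the homomorphism *)

Section FreeMorphism.
Variables (R : lmodType rat) (mulR : R -> R -> R) (P : R -> R).
Hypothesis RB : com_nonunitary_RBalgebra mulR P.
Variable r : R.

Let mul_lin := rb_mul_linearr RB.

(* [r^n / n!], with junk value [0] at [n = 0] since R has no unit. *)
Fixpoint divpow (n : nat) : R :=
  match n with
  | 0 => 0
  | n'.+1 => if n' is 0 then r else n%:R^-1 *: mulR r (divpow n')
  end.

(* [(ad m)^n (P) / n!] where [m] is the multiplication by [r]. *)
Fixpoint adP (n : nat) (y : R) : R :=
  match n with
  | 0 => P y
  | n'.+1 => n%:R^-1 *: (mulR r (adP n' y) - adP n' (mulR r y))
  end.

(* The image of [x1^n ++ w]. *)
Fixpoint word_image (n : nat) (w : word) : R :=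
  match w with
  | [::] => divpow n
  | a :: w' => if a == x1 then word_image n.+1 w' else adP n (word_image 0 w')
  end.

Definition lift_image (n : nat) : Qword -> R := lext (word_image n).

Definition lift (u : H_ge1) : R := lift_image 0 (eta_inv u).

HB.instance Definition _ n := GRing.isLinear.Build rat _ _ _ (lift_image n)
  (lext_is_linear _).

Lemma divpowS n : n.+2%:R *: divpow n.+2 = mulR r (divpow n.+1).
Proof.
by rewrite [divpow n.+2]/= scalerA mulfV ?scale1r // Num.Theory.pnatr_eq0.
Qed.

Lemma adPS n y : n.+1%:R *: adP n.+1 y = mulR r (adP n y) - adP n (mulR r y).
Proof. by rewrite scalerA mulfV ?scale1r // Num.Theory.pnatr_eq0. Qed.

Lemma adP_linear n : linear (adP n).
Proof.
elim: n => [|n IH] a x y /=; first exact: rb_op_linear RB a x y.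
rewrite mul_lin !IH mul_lin scalerA [a * _]mulrC -scalerA -scalerDr.
by rewrite scalerBr opprD addrACA.
Qed.

Lemma lift_image_x1 n x : lift_image n (prepend x1 x) = lift_image n.+1 x.
Proof.
elim/malg_ind: x => [|a x y ex ey|w]; first by rewrite !linear0.
  by rewrite !linearP /= ex ey.
by rewrite prependU /lift_image !lextU.
Qed.

Lemma lift_image_x0 n x :
  lift_image n (prepend x0 x) = adP n (lift_image 0 x).
Proof.
elim/malg_ind: x => [|a x y ex ey|w].
- by rewrite !linear0 (linear_0E (adP_linear n)).
- by rewrite !linearP /= adP_linear ex ey.
by rewrite prependU /lift_image !lextU.
Qed.

(* The left-hand side is the image of [x1 sh (x1^n ++ w)]. *)
Lemma lift_image_shuffle_x1 n w : last (0 < n)%N w ->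
  lift_image n (shuffle << [:: x1] >> << w >>) + n%:R *: word_image n.+1 w =
  mulR r (word_image n w).
Proof.
elim: w n => [|a w IH] n.
  (* For an empty word the condition on [last] forces [n] to be positive, so the junk value of
     [divpow] is avoided. *)
  case: n => // n _; rewrite shuffle1r /lift_image lextU.
  by rewrite -[RHS]divpowS -[n.+2]add1n natrD scalerDl scale1r.
rewrite -(prependU a w) shuffle_x1_prepend linearD /= lift_image_x1.
case: a => /= lw.
  (* A leading [x1] moves into the counter, and the extra term raises the coefficient from [n] to
     [n+1]. *)
  rewrite !lift_image_x1 -(IH n.+1) // {1}/lift_image lextU.
  by rewrite -[n.+1]add1n natrD scalerDl scale1r addrCA addrA.
(* After [x0] the counter restarts at 0. The [n+1] copies of [adP n.+1] then form the commutator of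
   [adP n] with multiplication by [r], and its subtracted term cancels. *)
rewrite !lift_image_x0; have := IH 0%N lw; rewrite scale0r addr0 => ->.
rewrite {1}/lift_image lextU addrAC -{1}[adP n.+1 _]scale1r -scalerDl.
by rewrite -(natrD _ 1 n) add1n adPS subrK.
Qed.

Lemma lift_linear : linear lift.
Proof. by move=> a u v; rewrite /lift !linearP. Qed.

Lemma lift_comp1 : lift << comp1 >> = r.
Proof. by rewrite /lift eta_inv_comp1 /lift_image lextU. Qed.

Lemma lift_I u : lift (I_H u) = P (lift u).
Proof. by rewrite /lift eta_inv_I lift_image_x0. Qed.

Lemma lift_mul_comp1 u : lift (mul_H << comp1 >> u) = mulR r (lift u).
Proof.
elim/malg_ind: u => [|a u v eu ev|s].
- rewrite (linear_0E (rb_mul_linearr mul_H_RB _)) (linear_0E lift_linear).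
  by rewrite (linear_0E (mul_lin r)).
- have := rb_mul_linearr mul_H_RB << comp1 >> a u v => /(congr1 lift).
  have /= -> := lift_linear a (mul_H << comp1 >> u) (mul_H << comp1 >> v).
  by have /= -> := lift_linear a u v; rewrite mul_lin -eu -ev.
rewrite /lift eta_inv_mul eta_inv_comp1 eta_inv_U.
(* No [x1] has been read yet, so the term with factor [n] vanishes. *)
have := @lift_image_shuffle_x1 0 (word_of s) (word_of_last s).
by rewrite scale0r addr0 => ->; rewrite /lift_image lextU.
Qed.

Lemma lift_mul : {morph lift : u v / mul_H u v >-> mulR u v}.
Proof.
apply: (RBalgebra_morph_gen mul_H_RB RB H_ge1_ind lift_linear lift_I) => u.
by rewrite lift_comp1; apply: lift_mul_comp1.
Qed.

Lemma lift_RBhom : nonunitary_RBhom mul_H I_H mulR P lift.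
Proof. by split; [exact: lift_linear | exact: lift_mul | exact: lift_I]. Qed.

End FreeMorphism.

(** * Uniqueness and freeness *)

(** The set where [f] and [g] agree is a subspace containing [[1]], stable under [I_H] and under
    multiplication by [[1]], hence everything by [H_ge1_ind]. *)
Lemma RBhom_ext (R : lmodType rat) (mulR : R -> R -> R) (P : R -> R)
    (f g : H_ge1 -> R) :
  nonunitary_RBhom mul_H I_H mulR P f -> nonunitary_RBhom mul_H I_H mulR P g ->
  f << comp1 >> = g << comp1 >> -> f =1 g.
Proof.
move=> [lf mf If] [lg mg Ig] fg1; apply: H_ge1_ind => //.
- by move=> a u v eu ev; rewrite lf lg eu ev.
- by move=> u eu; rewrite If Ig eu.
- by move=> u eu; rewrite mf mg fg1 eu.
Qed.

Theorem theorem3p1 :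
  com_nonunitary_RBalgebra mul_H I_H /\
  forall (R : lmodType rat) (mulR : R -> R -> R) (P : R -> R),
    com_nonunitary_RBalgebra mulR P ->
    forall r : R,
    exists f : H_ge1 -> R,
      (nonunitary_RBhom mul_H I_H mulR P f /\ f << comp1 >> = r) /\
      (forall g : H_ge1 -> R,
         nonunitary_RBhom mul_H I_H mulR P g -> g << comp1 >> = r -> g =1 f).
Proof.
split; first exact: mul_H_RB.
move=> R mulR P RB r; exists (lift mulR P r).
have hf := lift_RBhom RB r; have f1 := lift_comp1 mulR P r.
by split=> // g hg g1; apply: RBhom_ext hg hf _; rewrite g1 f1.
Qed.
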